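(* Let $(\mathbf{v}_i)_{i\ge1}$ be $[0,1]$-valued random variables that are conditionally i.i.d. given $\boldsymbol{\nu}$ with law $\boldsymbol{\nu}$, where $\boldsymbol{\nu}$ is a species sampling process on $[0,1]$ with base measure $\nu_0$ and EPPF $\pi_\nu$. Let $\mathbf{W}=(\mathbf{w}_j)_{j\ge1}$ with $\mathbf{w}_1=\mathbf{v}_1$, $\mathbf{w}_j=\mathbf{v}_j\prod_{i<j}(1-\mathbf{v}_i)$, and let $(\mathbf{d}_i)_{i\ge1}$ be conditionally i.i.d. given $\mathbf{W}$ with $\mathbb{P}[\mathbf{d}_i=j\mid\mathbf{W}]=\mathbf{w}_j$. Then for every $n\ge1$ and $d_1,\dots,d_n\in\mathbb{N}$, $$\mathbb{P}[\mathbf{d}_1=d_1,\dots,\mathbf{d}_n=d_n]=\sum_{\{A_1,\dots,A_m\}}\pi_\nu(|A_1|,\dots,|A_m|)\prod_{j=1}^m\int_{[0,1]}v^{\sum_{i\in A_j}r_i}(1-v)^{\sum_{i\in A_j}t_i}\,\nu_0(dv),$$ where $r_i=\sum_{l=1}^n\mathbf{1}_{\{d_l=i\}}$, $t_i=\sum_{l=1}^n\mathbf{1}_{\{d_l>i\}}$, and the sum ranges over all partitions $\{A_1,\dots,A_m\}$ of $\{1,\dots,k\}$ with $k=\max\{d_1,\dots,d_n\}$.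
   Context: A species sampling process on $[0,1]$ with diffuse base measure $\nu_0$ is a random probability measure $\boldsymbol{\nu}=\sum_{j\ge1}\mathbf{p}_j\delta_{\boldsymbol{\eta}_j}+(1-\sum_j\mathbf{p}_j)\nu_0$ with $\mathbf{p}_j\ge0$, $\sum_j\mathbf{p}_j\le1$ a.s., independent of i.i.d. atoms $\boldsymbol{\eta}_j\sim\nu_0$. Its EPPF is the symmetric function $\pi_\nu$ such that, for $(\mathbf{v}_i)$ conditionally i.i.d. from $\boldsymbol{\nu}$, the random partition of $\{1,\dots,k\}$ induced by ties among $\mathbf{v}_1,\dots,\mathbf{v}_k$ equals a given partition $\{A_1,\dots,A_m\}$ with probability $\pi_\nu(|A_1|,\dots,|A_m|)$. *)

(* Defs.v *)
From HB Require Import structures.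
From mathcomp Require Import all_boot all_order all_algebra.
From mathcomp Require Import all_classical all_reals all_analysis measurable_realfun.
Set Implicit Arguments. Unset Strict Implicit. Unset Printing Implicit Defensive.
Import Order.TTheory GRing.Theory Num.Theory.
Import numFieldNormedType.Exports.
Local Open Scope classical_set_scope.
Local Open Scope ring_scope.

Definition gen_sigma (T I : Type) (d' : measure_display) (U : measurableType d')
  (D : set I) (f : I -> T -> U) : set (set T) :=
  <<s [set S | exists i A, D i /\ measurable A /\ S = f i @^-1` A] >>.

Definition ssp_measure (T : Type) (R : realType) (nu0 : set R -> \bar R)
  (p eta : nat -> T -> R) (w : T) (B : set R) : \bar R :=
  (\sum_(j <oo) ((p j w) * \1_B (eta j w))%:E
    + (1 - \sum_(j <oo) (p j w)%:E) * nu0 B)%E.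

Definition diffuse_on01 (R : realType) (nu0 : probability R R) : Prop :=
  nu0 `[0%R, 1%R]%classic = 1%E /\ forall x : R, nu0 [set x] = 0%E.

(* (p_j), (eta_j) define a species sampling process with base measure nu0:
   p_j >= 0, sum_j p_j <= 1 a.s.; the eta_j are i.i.d. nu0 and the sequence
   (eta_j) is independent of the sequence (p_j). *)
Definition species_sampling (d : measure_display) (T : measurableType d)
  (R : realType) (P : probability T R) (nu0 : probability R R)
  (p eta : nat -> T -> R) : Prop :=
  [/\ (forall j, measurable_fun setT (p j)),
      (forall j, measurable_fun setT (eta j)),
      {ae P, forall w, (forall j, 0 <= p j w) /\ (\sum_(j <oo) (p j w)%:E <= 1)%E} &
      (forall (k : nat) (B : nat -> set R) (G : set T),
         (forall j, measurable (B j)) -> gen_sigma setT p G ->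
         P (G `&` \bigcap_(j in `I_k) (eta j @^-1` B j))
           = (P G * \prod_(j < k) nu0 (B j))%E)].

Definition cond_iid_given_measure (d : measure_display) (T : measurableType d)
  (R : realType) (P : probability T R) (nu : T -> set R -> \bar R)
  (v : nat -> T -> R) : Prop :=
  (forall i, measurable_fun setT (v i)) /\
  forall (k : nat) (B : nat -> set R) (G : set T),
    (forall i, measurable (B i)) ->
    @gen_sigma T (set R) _ (\bar R) measurable (fun B w => nu w B) G ->
    (P (G `&` \bigcap_(i in `I_k) (v i @^-1` B i))
      = \int[P]_(w in G) \prod_(i < k) nu w (B i))%E.

(* stick-breaking weights, indexed from 0: w_0 = v_0, w_j = v_j prod_{i<j}(1-v_i) *)
Definition stick (T : Type) (R : realType) (v : nat -> T -> R) (j : nat) (w : T) : R :=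
  v j w * \prod_(i < j) (1 - v i w).

Definition cond_iid_given_weights (d : measure_display) (T : measurableType d)
  (R : realType) (P : probability T R) (W : nat -> T -> R)
  (dd : nat -> T -> nat) : Prop :=
  (forall i j, measurable (dd i @^-1` [set j])) /\
  forall (n : nat) (e : 'I_n -> nat) (G : set T),
    gen_sigma setT W G ->
    (P (G `&` [set w | forall l : 'I_n, dd l w = e l])
      = \int[P]_(w in G) \prod_(l < n) (W (e l) w)%:E)%E.

Definition tie_partition (T : Type) (R : realType) (k : nat) (v : nat -> T -> R)
  (w : T) : {set {set 'I_k}} :=
  equivalence_partition [rel i j : 'I_k | v i w == v j w] [set: 'I_k]%SET.

(* k = max of the (0-indexed) labels, plus one *)
Definition kmax (n : nat) (e : 'I_n -> nat) : nat := (\max_(l : 'I_n) e l).+1.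

Definition rsum (n : nat) (e : 'I_n -> nat) (k : nat) (A : {set 'I_k}) : nat :=
  \sum_(i in A) #|[set l : 'I_n | e l == i]|.
Definition tsum (n : nat) (e : 'I_n -> nat) (k : nat) (A : {set 'I_k}) : nat :=
  \sum_(i in A) #|[set l : 'I_n | (i < e l)%N]|.

(* Main.v *)
Require Import Defs.
From HB Require Import structures.
From mathcomp Require Import all_boot all_order all_algebra.
From mathcomp Require Import all_classical all_reals all_analysis measurable_realfun.
From mathcomp Require Import zify.
Set Implicit Arguments.
Unset Strict Implicit.
Unset Printing Implicit Defensive.
Import Order.TTheory GRing.Theory Num.Theory.
Import numFieldNormedType.Exports.
Local Open Scope classical_set_scope.
Local Open Scope ring_scope.
Import HBNNSimple.

(** Write [nu] as a countable mixture of [nu0] (label 0) and the point masses at the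
atoms. Expanding [prod_i nu(B_i)] over the labels and using the independence of weights
and atoms, each choice of labels contributes its expected weight times the probability
that a vector of atoms, repeated according to the partition induced by the labels (the
indices with label 0 being singletons), falls in the rectangle. Hence the law of
[(v_1, ..., v_k)] is a finite mixture, over the partitions [Pi] of the indices, of the
laws of [(eta_{b(1)}, ..., eta_{b(k)})], where [b] numbers the blocks of [Pi]: both sides
agree on rectangles. As [nu0] is diffuse, the atoms are almost surely distinct, so the
mixture coefficient of [Pi] is the probability that the ties of [v] induce [Pi]. Finally
[prod_l w_{d_l} = prod_i v_i^{r_i} (1 - v_i)^{t_i}], whose expectation under each
component of the mixture factorizes over the blocks. *)

(** * Integration: from indicators and rectangles to general integrands *)

(** Simple functions inherit the identity from indicators by linearity, and monotone convergence
    carries it to [g]. The factor [h] holds the rest of a product while one factor at a time is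
    generalized; finiteness of [c] lets it pass through the limit. *)
Lemma ge0_integral_from_indic (d d' : measure_display) (T : measurableType d)
  (U : measurableType d') (R : realType) (P : {measure set T -> \bar R})
  (Q : {measure set U -> \bar R}) (X : T -> U) (h : T -> R) (g : U -> R)
  (c : \bar R) :
  measurable_fun setT X -> measurable_fun setT h -> (forall w, 0 <= h w) ->
  c \is a fin_num ->
  (forall B, measurable B ->
    \int[P]_w (h w * \1_B (X w))%:E = c * Q B)%E ->
  measurable_fun setT g -> (forall x, 0 <= g x) ->
  (\int[P]_w (h w * g (X w))%:E = c * \int[Q]_x (g x)%:E)%E.
Proof.
move=> mX mh h0 cfin hB mg g0.
have mEg : measurable_fun setT (EFin \o g) by exact/measurable_EFinP.
pose s := nnsfun_approx (measurableT : measurable [set: U]) mEg.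
have s0 n x : 0 <= s n x by [].
have sg x : (s n x)%:E @[n --> \oo] --> (g x)%:E.
  by apply: (cvg_nnsfun_approx _ mEg) => //= y _; rewrite lee_fin.
have nds x a b : (a <= b)%N -> s a x <= s b x.
  by move=> ab; exact/lefP/nd_nnsfun_approx.
have -> : (\int[Q]_x (g x)%:E = limn (fun n => \int[Q]_x (s n x)%:E))%E.
  rewrite -monotone_convergence//=.
  - by apply: eq_integral => x _; apply/esym/cvg_lim => //; exact: sg.
  - by move=> n; exact/measurable_EFinP.
  - by move=> n x _; rewrite lee_fin.
  - by move=> x _ a b ab; rewrite lee_fin nds.
have -> : (\int[P]_w (h w * g (X w))%:E =
    limn (fun n => \int[P]_w (h w * s n (X w))%:E))%E.
  rewrite -monotone_convergence//=.
  - apply: eq_integral => w _; apply/esym/cvg_lim => //.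
    under eq_fun do rewrite EFinM; rewrite EFinM.
    by apply: cvgeZl => //; exact: sg.
  - move=> n; apply/measurable_EFinP; apply: measurable_funM => //.
    exact: (measurableT_comp (measurable_funP (s n))).
  - by move=> n w _; rewrite lee_fin mulr_ge0.
  - by move=> w _ a b ab; rewrite lee_fin ler_wpM2l// nds.
rewrite -limeMl//; last first.
  apply: ereal_nondecreasing_is_cvgn => a b ab; apply: ge0_le_integral => //.
  - by move=> x _; rewrite lee_fin.
  - exact/measurable_EFinP.
  - exact/measurable_EFinP.
  - by move=> x _; rewrite lee_fin nds.
congr (limn _); apply/funext => n.
have ms r : measurable (s n @^-1` [set r]) by rewrite -[X in measurable X]setTI; exact: measurable_funP.
have r0 r : r \in range (s n) -> 0 <= r by rewrite inE => -[x _ <-].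
transitivity (\sum_(r \in range (s n)) \int[P]_w (r%:E * (h w * \1_(s n @^-1` [set r]) (X w))%:E))%E.
  rewrite -ge0_integral_fsum//; first last.
  - move=> r w _; rewrite -EFinM lee_fin indicE; case: (boolP (X w \in _)) => [|_].
      by rewrite inE => /= <-; rewrite !mulr_ge0.
    by rewrite !mulr0.
  - move=> r; apply: emeasurable_funM => //; apply/measurable_EFinP.
    apply: measurable_funM => //; apply: measurableT_comp => //.
  - apply: eq_integral => w _; rewrite fimfunE mulr_fsumr//.
    rewrite -fsumEFin//; apply: eq_fsbigr => r _.
    by rewrite -EFinM mulrCA.
rewrite integralT_nnsfun sintegralE ge0_mule_fsumr; last first.
  move=> r; exact: nnsfun_mulemu_ge0.
apply: eq_fsbigr => r rs.
rewrite ge0_integralZl//.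
- by rewrite hB// muleCA.
- apply/measurable_EFinP; apply: measurable_funM => //.
  by apply: measurableT_comp => //; exact: measurable_indic.
- by move=> w _; rewrite lee_fin mulr_ge0.
- by rewrite lee_fin r0.
Qed.

(* [ssp_measure] is a well-behaved series only almost surely, so its measurability is not
   readily available: the usual almost-everywhere lemma does not apply to it. *)
Lemma ae_eq_integral_nonmeasurable (d : measure_display) (T : measurableType d)
  (R : realType) (P : {measure set T -> \bar R}) (f g : T -> \bar R) :
  {ae P, forall w, f w = g w} -> (\int[P]_w f w = \int[P]_w g w)%E.
Proof.
move=> [N [mN N0 fgN]].
have fgE w : ~ N w -> f w = g w by move=> Nw; apply: contrapT => fg; exact/Nw/fgN.
(* An integral is a difference of two suprema over simple functions. One inequality between such
   suprema suffices: it is applied in both directions, to positive and to negative parts. *)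
suff H (u v : T -> \bar R) : (forall w, 0 <= v w)%E -> (forall w, ~ N w -> u w = v w) ->
    (ereal_sup [set sintegral P h | h in [set h : {nnsfun T >-> R} | forall x, ((h x)%:E <= u x)%E]] <=
    ereal_sup [set sintegral P h | h in [set h : {nnsfun T >-> R} | forall x, ((h x)%:E <= v x)%E]])%E.
  rewrite /integral !patch_setT.
  by congr (_ - _)%E; apply/eqP; rewrite eq_le; apply/andP; split; apply: H => // w Nw;
    rewrite ?funepos_ge0 ?funeneg_ge0// ?funeposE ?funenegE fgE.
move=> v0 uv; apply: ge_ereal_sup => _ [h hu <-].
have mNC : measurable (~` N) by exact: measurableC.
(* Setting [h] to 0 on the null set [N] keeps it below [v] everywhere, as [v] is nonnegative there,
   and does not lower its integral. *)
pose h' : {nnsfun T >-> R} := mul_nnsfun h (indic_nnsfun R mNC).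
have h'E w : h' w = h w * \1_(~` N) w by [].
apply: ereal_sup_ge; exists (sintegral P h').
  exists h' => // w; rewrite h'E indicE; case: (boolP (w \in ~` N)) => wN.
    by rewrite mulr1 -uv//; move: wN; rewrite inE.
  by rewrite mulr0.
rewrite -2!integralT_nnsfun; apply: ae_ge0_le_integral => //.
- by move=> w _; rewrite lee_fin.
- exact/measurable_EFinP.
- by move=> w _; rewrite lee_fin.
- exact/measurable_EFinP.
- exists N; split => // w /= hw; apply: contrapT => Nw; apply: hw => _.
  by rewrite -[X in (_ <= X)%E]/((h w * \1_(~` N) w)%:E) indicE mem_set// mulr1.
Qed.

(** Rectangles form a generator stable under intersection, as uniqueness of measures requires. A
    coordinate preimage is a rectangle whose other sides are full. *)
Lemma measurable_tuple_rectangles (d : measure_display) (T : measurableType d) (k : nat) :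
  @measurable _ (k.-tuple T) =
  <<s [set S | exists B : 'I_k -> set T, (forall i, measurable (B i)) /\
         S = [set x | forall i, B i (tnth x i)]] >>.
Proof.
rewrite eqEsubset; split; apply: smallest_sub => //.
- rewrite -bigcup_seq => S /= [i _ [A mA <-]]; apply: sub_sigma_algebra => /=.
  exists (fun j => if j == i then A else setT); split; first by move=> j; case: ifP.
  rewrite setTI; apply/seteqP; split => x /=; last by move/(_ i); rewrite eqxx.
  by move=> Ax j; case: eqP => // ->.
- exact: sigma_algebra_measurable.
- move=> S [B [mB ->]].
  rewrite (_ : [set _ | _] = \bigcap_(i in [set: 'I_k]) ((@tnth _ T ^~ i) @^-1` B i)).
    apply: fin_bigcap_measurable => [|i _]; first exact: finite_finset.
    by rewrite -[X in measurable X]setTI; exact: measurable_tnth.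
  by apply/seteqP; split => x /= Bx i; [move=> _; exact: Bx|exact: Bx].
Qed.

(** The law of [V] and the weighted sum of the laws of the [Y j] are finite measures that agree on
    rectangles, hence are equal. *)
Lemma mixture_integral (d d' : measure_display) (W : measurableType d)
  (T : measurableType d') (R : realType) (P : probability W R) (k : nat) (I : finType)
  (V : W -> k.-tuple T) (Y : I -> W -> k.-tuple T) (a : I -> \bar R) :
  measurable_fun setT V -> (forall j, measurable_fun setT (Y j)) ->
  (forall j, 0 <= a j)%E ->
  (forall B : 'I_k -> set T, (forall i, measurable (B i)) ->
     P [set w | forall i, B i (tnth (V w) i)] =
     \sum_j a j * P [set w | forall i, B i (tnth (Y j w) i)])%E ->
  forall F : k.-tuple T -> \bar R, measurable_fun setT F -> (forall x, 0 <= F x)%E ->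
  (\int[P]_w F (V w) = \sum_j a j * \int[P]_w F (Y j w))%E.
Proof.
move=> mV mY a0 rect F mF F0.
(* The full rectangle shows that the coefficients sum to 1; so they are finite and can scale
   measures. *)
have atot : (\sum_j a j = 1)%E.
  have E : [set w : W | forall i : 'I_k, [set: T] (tnth (V w) i)] = setT.
    by apply/seteqP; split.
  have /= := rect (fun=> setT) (fun=> measurableT).
  rewrite E probability_setT => ->; apply: eq_bigr => j _.
  by rewrite mule1.
have afin j : a j \is a fin_num.
  rewrite ge0_fin_numE//; apply: (@le_lt_trans _ _ 1%E); last exact: ltry.
  by rewrite -atot (bigD1 j)//= leeDl// sume_ge0.
(* [msum] is indexed by naturals, so [I] is enumerated, with [j0] as default for [nth]; an empty [I]
   would make the sum 0 instead of 1. *)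
case: (pickP (@predT I)) => [j0 _|I0]; last first.
  have : (\sum_j a j = 0)%E by rewrite big_pred0.
  by rewrite atot => /eqP; rewrite onee_eq0.
pose e n := nth j0 (enum I) n.
have sum_e (G : I -> \bar R) : (\sum_(n < #|I|) G (e n) = \sum_j G j)%E.
  by rewrite -[RHS]big_enum (big_nth j0) big_mkord -cardE.
have cpos n : (0 <= fine (a (e n)))%R by exact: fine_ge0.
pose V' : {RV P >-> k.-tuple T} := HB.pack V (isMeasurableFun.Build _ _ _ _ V mV).
pose Y' j : {RV P >-> k.-tuple T} :=
  HB.pack (Y j) (isMeasurableFun.Build _ _ _ _ (Y j) (mY j)).
pose m_ n : {measure set (k.-tuple T) -> \bar R} :=
  mscale (NngNum (cpos n)) (distribution P (Y' (e n))).
have mE A : measurable A -> distribution P V' A = msum m_ #|I| A.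
  apply: (measure_unique _ (fun=> setT) (measurable_tuple_rectangles _ _)) => //=.
  - move=> A1 A2 [B1 [mB1 ->]] [B2 [mB2 ->]]; exists (fun i => B1 i `&` B2 i); split.
      by move=> i; exact: measurableI.
    apply/seteqP; split => x /=; first by move=> [? ?] i.
    by move=> H; split=> i; have [] := H i.
  - move=> _; exists (fun=> setT); split => //; by apply/seteqP; split.
  - by rewrite bigcup_const.
  - move=> _ [B [mB ->]]; rewrite /distribution /pushforward /msum /=.
    transitivity (P [set w | forall i, B i (tnth (V w) i)]); first by [].
    rewrite rect// -(sum_e (fun j => _)); apply: eq_bigr => n _.
    by rewrite /mscale /= /distribution /pushforward /= fineK.
  - by move=> _; rewrite probability_setT ltry.
rewrite -(ge0_integral_distribution V')//.
rewrite (eq_measure_integral (msum m_ #|I|)); last by move=> A mA _; exact: mE.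
rewrite ge0_integral_measure_sum// -(sum_e (fun j => _)); apply: eq_bigr => n _.
by rewrite ge0_integral_mscale//= fineK// ge0_integral_distribution.
Qed.

Lemma prod_indic (T U : Type) (R : realType) (I : finType) (C : I -> set U)
  (f : I -> T -> U) (w : T) :
  \prod_i \1_(C i) (f i w) = \1_[set w | forall i, C i (f i w)] w :> R.
Proof.
rewrite [RHS]indicE; have [/set_mem /= H|/negP H] := boolP (w \in _).
  by apply: big1 => i _; rewrite indicE mem_set.
have [i Ci] : exists i, ~ C i (f i w).
  by apply/existsNP => H'; apply: H; rewrite inE.
by rewrite (bigD1 i)//= indicE memNset// mul0r.
Qed.

Lemma measurable_forall (d d' : measure_display) (T : measurableType d)
  (U : measurableType d') (I : finType) (C : I -> set U) (f : I -> T -> U) :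
  (forall i, measurable (C i)) -> (forall i, measurable_fun setT (f i)) ->
  measurable [set w | forall i, C i (f i w)].
Proof.
move=> mC mf.
rewrite (_ : [set _ | _] = \bigcap_(i in [set: I]) (f i @^-1` C i)).
  apply: fin_bigcap_measurable => [|i _]; first exact: finite_finset.
  by rewrite -[X in measurable X]setTI; exact: mf.
by apply/seteqP; split => x /= Bx i; [move=> _; exact: Bx|exact: Bx].
Qed.

Lemma probability_integral1 (d : measure_display) (T : measurableType d) (R : realType)
  (P : probability T R) : (\int[P]_w 1 = 1)%E.
Proof. by rewrite integral_cst// mul1e; exact: probability_setT. Qed.

Lemma integral_le1_fin_num (d : measure_display) (T : measurableType d) (R : realType)
  (P : probability T R) (f : T -> R) : measurable_fun setT f ->
  (forall w, 0 <= f w <= 1) -> (\int[P]_w (f w)%:E)%E \is a fin_num.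
Proof.
move=> mf f01; rewrite ge0_fin_numE; last first.
  by apply: integral_ge0 => w _; rewrite lee_fin; case/andP: (f01 w).
apply: (@le_lt_trans _ _ (\int[P]_w 1))%E; last first.
  by rewrite probability_integral1 ltry.
apply: ge0_le_integral => //.
- by move=> w _; rewrite lee_fin; case/andP: (f01 w).
- exact/measurable_EFinP.
- by move=> w _; rewrite lee_fin; case/andP: (f01 w).
Qed.

Lemma prodr_itv01 (R : realType) (I : Type) (s : seq I) (Q : pred I) (F : I -> R) :
  (forall i, Q i -> 0 <= F i <= 1) -> 0 <= \prod_(i <- s | Q i) F i <= 1.
Proof.
move=> F01; rewrite prodr_ile1// andbT; apply: prodr_ge0 => i Qi.
by case/andP: (F01 i Qi).
Qed.

(* [g_sigma_algebraType (preimages p)] is [T] with the sigma-algebra generated by [p]. *)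
Definition preimages (T : Type) (R : realType) (p : nat -> T -> R) : set (set T) :=
  [set S | exists i A, setT i /\ measurable A /\ S = p i @^-1` A].

(** * Independence of weights and atoms, at the level of integrals *)

Lemma measurable_fun_preimages (d : measure_display) (T : measurableType d)
  (R : realType) (P : probability T R) (nu0 : probability R R) (p eta : nat -> T -> R)
  (phi : T -> R) : species_sampling P nu0 p eta ->
  @measurable_fun _ _ (g_sigma_algebraType (preimages p)) R setT phi ->
  measurable_fun (setT : set T) phi.
Proof.
move=> [mp _ _ _] mphi _ A mA; rewrite setTI.
have := mphi measurableT A mA; rewrite setTI; move: (_ @^-1` _).
apply: smallest_sub; first exact: sigma_algebra_measurable.
by move=> _ [i [B [_ [mB ->]]]]; rewrite -[X in measurable X]setTI; exact: mp.
Qed.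

(** The hypothesis speaks of events only. The event on the weights is first generalized to [phi],
    then the indicators on the atoms are generalized to the [g j], one atom at a time. *)
Lemma indep_integral (d : measure_display) (T : measurableType d) (R : realType)
  (P : probability T R) (nu0 : probability R R) (p eta : nat -> T -> R) :
  species_sampling P nu0 p eta ->
  forall phi : T -> R,
  @measurable_fun _ _ (g_sigma_algebraType (preimages p)) R setT phi ->
  (forall w, 0 <= phi w <= 1) ->
  forall (m : nat) (g : nat -> R -> R),
  (forall j, measurable_fun setT (g j)) -> (forall j x, 0 <= g j x <= 1) ->
  (\int[P]_w (phi w * \prod_(j < m) g j (eta j w))%:E =
   \int[P]_w (phi w)%:E * \prod_(j < m) \int[nu0]_x (g j x)%:E)%E.
Proof.
move=> ssp phi mphi phi01 m.
have mphiT := measurable_fun_preimages ssp mphi.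
case: ssp => mp meta _ indep.
pose U := g_sigma_algebraType (preimages p).
have midU : measurable_fun (setT : set T) (id : T -> U).
  move=> _ A mA; rewrite setTI; move: A mA.
  apply: smallest_sub; first exact: sigma_algebra_measurable.
  move=> _ [i [A [_ [mA ->]]]]; rewrite -[X in measurable X]setTI; exact: mp.
(* The law of this identity is [P] restricted to the sigma-algebra of the weights, which turns [phi]
   into a function of a random element. *)
pose idU : {RV P >-> U} := HB.pack (id : T -> U) (isMeasurableFun.Build _ _ _ _ (id : T -> U) midU).
have base (C : nat -> set R) : (forall j, measurable (C j)) ->
    (\int[P]_w (phi w * \prod_(j < m) \1_(C j) (eta j w))%:E =
     \int[P]_w (phi w)%:E * \prod_(j < m) nu0 (C j))%E.
  move=> mC; rewrite muleC.
  have -> : (\int[P]_w (phi w)%:E = \int[distribution P idU]_w (phi w)%:E)%E.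
    rewrite ge0_integral_distribution//; first exact/measurable_EFinP.
    by move=> w; rewrite lee_fin; case/andP: (phi01 w).
  have mH : measurable [set w | forall j : 'I_m, C j (eta j w)].
    by apply: (@measurable_forall _ _ _ _ _ (fun j : 'I_m => C j) (fun j => eta j)).
  transitivity (\int[P]_w (\1_[set w | forall j : 'I_m, C j (eta j w)] w * phi w)%:E)%E.
    apply: eq_integral => w _.
    by rewrite mulrC (prod_indic _ (fun j : 'I_m => C j) (fun j => eta j)).
  apply: (@ge0_integral_from_indic _ _ T U R P (distribution P idU) idU
    (\1_[set w | forall j : 'I_m, C j (eta j w)]) phi _ midU) => //.
  - by apply: prode_fin_num => j _; exact: fin_num_measure.
  - move=> B mB.
    have mBT : measurable (B : set T) by rewrite -[X in measurable X]setTI; exact (midU measurableT B mB).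
    under eq_integral do rewrite -[(_ * _)%R]/((\1__ \* \1__) _) -indicI.
    rewrite integral_indic//; last exact: measurableI.
    rewrite setIT muleC -indep//; congr (P _).
    rewrite setIC; congr (_ `&` _); apply/seteqP; split => w /=.
      by move=> H j jm; exact: (H (Ordinal jm)).
    by move=> H j; exact: (H j (ltn_ord j)).
  - by move=> w; case/andP: (phi01 w).
(* Induction on [s]: the functions numbered below [s] are arbitrary, those from [s] on are still
   indicators. The goal is the case [s = m]. *)
suff H s : forall g : nat -> R -> R,
    (forall j, measurable_fun setT (g j)) -> (forall j x, 0 <= g j x <= 1) ->
    (forall j, (s <= j < m)%N -> exists2 C, measurable C & g j = \1_C) ->
    (\int[P]_w (phi w * \prod_(j < m) g j (eta j w))%:E =
     \int[P]_w (phi w)%:E * \prod_(j < m) \int[nu0]_x (g j x)%:E)%E.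
  by move=> g mg g01; apply: (H m) => // j /andP[/leq_ltn_trans/[apply]]; rewrite ltnn.
elim: s => [|s IH] g mg g01 gs.
  have /choice[C HC] : forall j, exists C, measurable C /\ ((j < m)%N -> g j = \1_C).
    move=> j; have [jm|jm] := boolP (j < m)%N; last by exists setT.
    by have [C mC gC] := gs j jm; exists C.
  under eq_integral => w _.
    under eq_bigr => j _ do rewrite (HC j).2//; over.
  rewrite base => [|j]; last exact: (HC j).1.
  congr (_ * _)%E; apply: eq_bigr => j _.
  by rewrite (HC j).2// integral_indic// ?setIT//; exact: (HC j).1.
have [ms|sm] := leqP m s.
  by apply: IH => // j /andP[sj jm]; move: (leq_ltn_trans (leq_trans ms sj) jm); rewrite ltnn.
pose js := Ordinal sm.
transitivity (\int[P]_w ((phi w * \prod_(j < m | j != js) g j (eta j w)) * g s (eta s w))%:E)%E.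
  by apply: eq_integral => w _; rewrite (bigD1 js)//= mulrCA mulrC.
rewrite (bigD1 js)//= [X in (_ * X)%E]muleC muleA.
apply: (ge0_integral_from_indic (g := g s) (meta s)) => //.
- apply: measurable_funM => //; under eq_fun do rewrite -big_filter.
  by apply: measurable_prod => j _; exact: measurableT_comp.
- move=> w; apply: mulr_ge0; first by case/andP: (phi01 w).
  by have /andP[] := @prodr_itv01 R _ (index_enum 'I_m) (fun j => j != js)
     (fun j => g j (eta j w)) (fun j _ => g01 j _).
- rewrite fin_numM//; first exact: integral_le1_fin_num.
  by apply: prode_fin_num => j _; exact: integral_le1_fin_num.
(* With an indicator in position [s], the induction hypothesis provides the identity that
   [ge0_integral_from_indic] extends to [g s]. *)
- move=> B mB; pose g' j := if j == s then \1_B else g j.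
  have := IH g'; rewrite /g'.
  have -> : (\prod_(j < m) \int[nu0]_x ((if j == s :> nat then \1_B else g j) x)%:E =
     nu0 B * \prod_(j < m | j != js) \int[nu0]_x (g j x)%:E)%E.
    rewrite (bigD1 js)//= eqxx integral_indic// setIT; congr (_ * _)%E.
    by apply: eq_bigr => j; rewrite -val_eqE /= => /negbTE ->.
  rewrite [X in (_ * X)%E]muleC muleA => <-.
  + apply: eq_integral => w _; congr EFin.
    rewrite [in RHS](bigD1 js)//= eqxx [RHS]mulrCA [RHS]mulrC; congr (_ * _ * _).
    by apply: eq_bigr => j; rewrite -val_eqE /= => /negbTE ->.
  + by move=> j; case: ifP => // _; exact: measurable_indic.
  + move=> j x; case: ifP => // _; rewrite indicE; case: (_ \in _) => /=; by rewrite ?lexx ?ler01.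
  + move=> j /andP[sj jm]; case: eqP => [_|/eqP js']; first by exists B.
    by apply: gs; rewrite jm ltn_neqAle eq_sym js' sj.
- by move=> x; case/andP: (g01 s x).
Qed.

(** * Products over the blocks of a partition induced by a map *)

Lemma eq_preim_partition (I : finType) (V V' : eqType) (f : I -> V) (g : I -> V') :
  (forall i j, (f i == f j) = (g i == g j)) ->
  preim_partition f [set: I]%SET = preim_partition g [set: I]%SET.
Proof.
move=> fg; apply: eq_imset => i; apply/setP => j; by rewrite !inE fg.
Qed.

(** Blocks are the nonempty fibres of [f]; a value that [f] misses contributes [Phi] of the empty
    set, that is 1. *)
Lemma prod_preim_partition (R : realType) (I J : finType) (f : I -> J)
  (Phi : {set I} -> \bar R) : Phi finset.set0 = 1%E ->
  (\prod_(A in preim_partition f [set: I]%SET) Phi A =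
   \prod_j Phi [set i | f i == j]%SET)%E.
Proof.
move=> Phi0.
have -> : preim_partition f [set: I]%SET =
    [set [set i | f i == j]%SET | j in [set f i | i in [set: I]%SET]%SET]%SET.
  rewrite -imset_comp; apply: eq_imset => i /=; apply/setP => j.
  by rewrite !inE eq_sym.
rewrite big_imset => [|j j' /imsetP[i _ ->] /imsetP[i' _ ->] /setP/(_ i)]; last first.
  by rewrite !inE eqxx => /esym/eqP.
rewrite big_mkcond; apply: eq_bigr => j _; case: ifPn => // /imsetP jf.
rewrite (_ : [set i | f i == j]%SET = finset.set0)//; apply/setP => i.
by rewrite !inE; apply/negP => /eqP fij; apply: jf; exists i.
Qed.

Lemma measurable_prod_cond (d : measure_display) (T : measurableType d) (R : realType)
  (I : finType) (Q : pred I) (h : I -> T -> R) :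
  (forall i, measurable_fun setT (h i)) ->
  measurable_fun setT (fun x => \prod_(i | Q i) h i x).
Proof.
by move=> mh; under eq_fun do rewrite -big_filter; exact: measurable_prod.
Qed.

Lemma indic_itv01 (T : Type) (R : realType) (A : set T) (x : T) : 0 <= (\1_A x : R) <= 1.
Proof. by rewrite indicE; case: (_ \in _); rewrite /= ?lexx ler01. Qed.

(** All indices reading the same atom are gathered into one function of that atom; distinct atoms
    are independent. *)
Lemma indep_integral_partition (d : measure_display) (T : measurableType d) (R : realType)
  (P : probability T R) (nu0 : probability R R) (p eta : nat -> T -> R) (k m : nat)
  (s : 'I_k -> 'I_m) (f : 'I_k -> R -> R) :
  species_sampling P nu0 p eta ->
  (forall i, measurable_fun setT (f i)) -> (forall i x, 0 <= f i x <= 1) ->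
  (\int[P]_w (\prod_(i < k) f i (eta (s i) w))%:E =
   \prod_(A in preim_partition s [set: 'I_k]%SET)
     \int[nu0]_x (\prod_(i in A) f i x)%:E)%E.
Proof.
move=> ssp mf f01.
rewrite prod_preim_partition; last first.
  under eq_integral do rewrite big_set0.
  by rewrite probability_integral1.
pose g (j : nat) x := \prod_(i < k | s i == j :> nat) f i x.
transitivity (\int[P]_w (cst 1 w * \prod_(j < m) g j (eta j w))%:E)%E.
  apply: eq_integral => w _; rewrite mul1r (partition_big s predT)//=; congr EFin.
  by apply: eq_bigr => j _; apply: eq_bigr => i /eqP ->.
rewrite (indep_integral ssp) => //.
- rewrite probability_integral1 mul1e; apply: eq_bigr => j _.
  by apply: eq_integral => x _; congr EFin; apply: eq_bigl => i; rewrite inE.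
- by move=> w; rewrite /cst lexx ler01.
- by move=> j; exact: measurable_prod_cond.
- by move=> j x; apply: prodr_itv01 => i _; exact: f01.
Qed.

(** * Expectation of one choice of labels *)

(** For a partition [Pi], this is the probability that [k] draws from [nu0], equal within blocks and
    independent across them, fall in the rectangle with sides [B i]. *)
Definition block_weight (R : realType) (nu0 : probability R R) (k : nat)
  (B : nat -> set R) (Pi : {set {set 'I_k}}) : \bar R :=
  (\prod_(A in Pi) \int[nu0]_x (\prod_(i in A) \1_(B i) x)%:E)%E.

(* Label 0 stands for the diffuse part nu0, label j.+1 for the atom eta j. *)
Definition component (T : Type) (R : realType) (nu0 : set R -> \bar R)
  (eta : nat -> T -> R) (B : set R) (N : nat) (j : 'I_N.+1) (w : T) : R :=
  if unlift ord0 j is Some j' then \1_B (eta j' w) else fine (nu0 B).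

(* Indices drawn from the diffuse part are almost surely not tied to any other one. *)
Definition label_partition (k N : nat) (c : 'I_k -> 'I_N.+1) : {set {set 'I_k}} :=
  preim_partition
    (fun i => (c i : nat, if c i == 0 :> nat then i.+1 else 0%N)) [set: 'I_k]%SET.

(** An index with label 0 contributes the constant [nu0 (B i)], which is also the factor of its
    singleton block. The other indices are grouped by atom and factorize by independence. *)
Lemma integral_component (d : measure_display) (T : measurableType d) (R : realType)
  (P : probability T R) (nu0 : probability R R) (p eta : nat -> T -> R) :
  species_sampling P nu0 p eta ->
  forall phi : T -> R,
  @measurable_fun _ _ (g_sigma_algebraType (preimages p)) R setT phi ->
  (forall w, 0 <= phi w <= 1) ->
  forall (k N : nat) (c : 'I_k -> 'I_N.+1) (B : nat -> set R),
  (forall i, measurable (B i)) ->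
  (\int[P]_w (phi w * \prod_(i < k) component nu0 eta (B i) (c i) w)%:E =
   \int[P]_w (phi w)%:E * block_weight nu0 B (label_partition c))%E.
Proof.
move=> ssp phi mphi phi01 k N c B mB.
(* The label partition as fibres of a map: the first [N] values are the atoms, and each index [i]
   with label 0 gets a value [N + i] of its own. *)
pose s i : 'I_(N + k) := if unlift ord0 (c i) is Some j then lshift k j else rshift N i.
have -> : label_partition c = preim_partition s [set: 'I_k]%SET.
  apply: eq_preim_partition => i j; rewrite /s.
  case: unliftP => [ci|] ->; case: unliftP => [cj|] ->; rewrite -!val_eqE /= xpair_eqE /=.
  - by rewrite eqxx andbT /bump; lia.
  - by have := ltn_ord ci; rewrite /bump /=; lia.
  - by have := ltn_ord cj; rewrite /bump /=; lia.
  - by rewrite eqn_add2l eqSS.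
rewrite /block_weight prod_preim_partition; last first.
  under eq_integral do rewrite big_set0.
  by rewrite probability_integral1.
(* [g j] collects the sides tested on atom [j], and [K] the constants of the indices with label
   0. *)
pose g (j : nat) x : R := \prod_(i < k | omap val (unlift ord0 (c i)) == Some j) \1_(B i) x.
pose K : R := \prod_(i < k | unlift ord0 (c i) == None) fine (nu0 (B i)).
have K0 : 0 <= K by apply: prodr_ge0 => i _; exact: fine_ge0.
have mg j : measurable_fun setT (g j).
  by apply: measurable_prod_cond => i; exact: measurable_indic.
have g01 j x : 0 <= g j x <= 1 by apply: prodr_itv01 => i _; exact: indic_itv01.
transitivity (\int[P]_w (K%:E * (phi w * \prod_(j < N) g j (eta j w))%:E))%E.
  apply: eq_integral => w _; rewrite -EFinM mulrCA; congr (_ * _)%:E.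
  rewrite (bigID (fun i => unlift ord0 (c i) == None))/=; congr (_ * _).
    by apply: eq_bigr => i /eqP ci; rewrite /component ci.
  under [RHS]eq_bigr do rewrite /g big_mkcond.
  rewrite exchange_big big_mkcond; apply: eq_bigr => i _; rewrite /component.
  case: unliftP => [ci|] _ /=; last by rewrite big1.
  rewrite (bigD1 ci)//= eqxx big1 ?mulr1// => j; rewrite -val_eqE /= => /negbTE jci.
  by case: eqP => // -[] /eqP; rewrite eq_sym jci.
have mphiT := measurable_fun_preimages ssp mphi.
rewrite ge0_integralZl//; first last.
- move=> w _; rewrite lee_fin mulr_ge0//; first by case/andP: (phi01 w).
  by have /andP[] := @prodr_itv01 R _ (index_enum 'I_N) predT
     (fun j => g j (eta j w)) (fun j _ => g01 j _).
- apply/measurable_EFinP; apply: measurable_funM => //.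
  apply: measurable_prod => j _; apply: measurableT_comp => //.
  by case: ssp.
rewrite (indep_integral ssp)// muleCA; congr (_ * _)%E.
rewrite big_split_ord/= muleC; congr (_ * _)%E.
  apply: eq_bigr => j _; apply: eq_integral => x _; congr EFin.
  apply: eq_bigl => i; rewrite inE /s; case: unliftP => [ci|] _ /=.
    by rewrite eq_lshift.
  by rewrite eq_rlshift.
(* The fibre over [N + i] is the singleton of [i] when [i] has label 0, giving [nu0 (B i)];
   otherwise it is empty, giving 1. *)
rewrite /K -prodEFin big_mkcond/=; apply: eq_bigr => i _.
have [ci|ci] := eqVneq (unlift ord0 (c i)) None.
  rewrite (_ : [set _ | _]%SET = [set i]%SET); last first.
    apply/setP => j; rewrite !inE /s; have [->|ji] := eqVneq j i.
      by rewrite ci eqxx.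
    by case: unliftP => [cj|] _; rewrite ?eq_lrshift// eq_rshift (negbTE ji).
  under eq_integral do rewrite big_set1.
  by rewrite integral_indic// setIT fineK// fin_num_measure.
rewrite (_ : [set _ | _]%SET = finset.set0); last first.
  apply/setP => j; rewrite !inE /s.
  case: unliftP => [cj|] cj_; rewrite ?eq_lrshift// eq_rshift.
  by apply/negP => /eqP ji; move: ci; rewrite -ji cj_ unlift_none.
under eq_integral do rewrite big_set0.
by rewrite probability_integral1.
Qed.

(** * Truncation of the species sampling process to finitely many atoms *)

Section truncated_mixture.
Context (d : measure_display) (T : measurableType d) (R : realType).
Context (nu0 : probability R R) (p eta : nat -> T -> R).

(** Bounding real partial sums, rather than the extended series, presents this almost sure event as
    a countable intersection of events of the weights. *)
Definition proper_weights : set T :=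
  [set w | (forall j, 0 <= p j w) /\ forall N, \sum_(j < N) p j w <= 1].

(** The cutoff makes bounds and convergence hold at every point, not just almost surely; off the
    event all mass goes to [nu0]. *)
Definition atom_weight (j : nat) (w : T) : R := p j w * \1_proper_weights w.

Definition atom_mass (N : nat) (w : T) : R := \sum_(j < N) atom_weight j w.

(** Label 0 receives the diffuse mass of the full process, whatever [N] is. The truncated weights
    may thus sum to less than 1, but the truncated mixtures increase with [N]. *)
Definition weight (N : nat) (j : 'I_N.+1) (w : T) : R :=
  if unlift ord0 j is Some j' then atom_weight j' w else 1 - limn (atom_mass ^~ w).

Definition truncated_mixture (N : nat) (B : set R) (w : T) : R :=
  \sum_(j < N.+1) weight j w * component nu0 eta B j w.

Lemma atom_weight_proper j w : proper_weights w -> atom_weight j w = p j w.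
Proof. by move=> wp; rewrite /atom_weight indicE mem_set// mulr1. Qed.

Lemma atom_weight_improper j w : ~ proper_weights w -> atom_weight j w = 0.
Proof. by move=> wp; rewrite /atom_weight indicE memNset// mulr0. Qed.

Lemma atom_weight_ge0 j w : 0 <= atom_weight j w.
Proof.
have [wp|wp] := pselect (proper_weights w); last by rewrite atom_weight_improper.
by rewrite atom_weight_proper//; case: wp.
Qed.

Lemma atom_mass_le1 N w : atom_mass N w <= 1.
Proof.
have [wp|wp] := pselect (proper_weights w); rewrite /atom_mass.
  by under eq_bigr do rewrite atom_weight_proper//; case: wp.
by rewrite big1// => j _; rewrite atom_weight_improper.
Qed.

Lemma nondecreasing_atom_mass w : nondecreasing_seq (atom_mass ^~ w).
Proof.
apply/nondecreasing_seqP => N; rewrite /atom_mass big_ord_recr/= lerDl.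
exact: atom_weight_ge0.
Qed.

Lemma is_cvg_atom_mass w : cvgn (atom_mass ^~ w).
Proof.
apply: nondecreasing_is_cvgn; first exact: nondecreasing_atom_mass.
by exists 1 => _ [N _ <-]; exact: atom_mass_le1.
Qed.

Lemma atom_mass_le_lim N w : atom_mass N w <= limn (atom_mass ^~ w).
Proof. exact: (nondecreasing_cvgn_le (@nondecreasing_atom_mass w) (@is_cvg_atom_mass w)). Qed.

Lemma atom_mass_lim_le1 w : limn (atom_mass ^~ w) <= 1.
Proof.
apply: limr_le; first exact: is_cvg_atom_mass.
by near=> N; exact: atom_mass_le1.
Unshelve. all: by end_near. Qed.

Lemma weight_itv01 N (j : 'I_N.+1) w : 0 <= weight j w <= 1.
Proof.
rewrite /weight; case: unliftP => [j'|] _.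
  rewrite atom_weight_ge0/=; apply: le_trans (atom_mass_le1 j'.+1 w).
  rewrite /atom_mass big_ord_recr/= lerDr; apply: sumr_ge0 => i _.
  exact: atom_weight_ge0.
rewrite subr_ge0 atom_mass_lim_le1 gerBl.
by apply: le_trans (atom_mass_le_lim 0 w); rewrite /atom_mass big_ord0.
Qed.

Lemma component_ge0 N (j : 'I_N.+1) B w : 0 <= component nu0 eta B j w.
Proof.
rewrite /component; by case: unliftP => [j'|] _; last exact: fine_ge0.
Qed.

Lemma truncated_mixtureE N B w : truncated_mixture N B w =
  (1 - limn (atom_mass ^~ w)) * fine (nu0 B) +
  \sum_(j < N) atom_weight j w * \1_B (eta j w).
Proof.
rewrite /truncated_mixture big_ord_recl /weight /component unlift_none.
by congr (_ + _); apply: eq_bigr => j _; rewrite liftK.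
Qed.

Lemma truncated_mixture_ge0 N B w : 0 <= truncated_mixture N B w.
Proof.
apply: sumr_ge0 => j _; rewrite mulr_ge0 ?component_ge0//.
by case/andP: (weight_itv01 j w).
Qed.

Lemma nondecreasing_truncated_mixture B w :
  nondecreasing_seq (fun N => truncated_mixture N B w).
Proof.
apply/nondecreasing_seqP => N; rewrite !truncated_mixtureE lerD2l big_ord_recr/= lerDl.
by rewrite mulr_ge0 ?atom_weight_ge0.
Qed.

(** Both series are nondecreasing and bounded by 1, so the limit is taken in the reals, where
    products of limits are unproblematic. *)
Lemma cvg_truncated_mixture B w : measurable B -> proper_weights w ->
  exists r : R, ssp_measure nu0 p eta w B = r%:E /\
    truncated_mixture N B w @[N --> \oo] --> r.
Proof.
move=> mB wp.
have mass_cvg : (\sum_(j <oo) (p j w)%:E)%E = (limn (atom_mass ^~ w))%:E.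
  apply/cvg_lim => //; rewrite (_ : (fun n => _) = EFin \o (atom_mass ^~ w)).
    by apply: cvg_EFin; [exact: nearW|exact: is_cvg_atom_mass].
  apply/funext => N /=; rewrite big_mkord sumEFin; congr EFin.
  by apply: eq_bigr => j _; rewrite atom_weight_proper.
pose u N := \sum_(j < N) atom_weight j w * \1_B (eta j w).
have u_cvg : cvgn u.
  apply: nondecreasing_is_cvgn.
    apply/nondecreasing_seqP => N; rewrite /u big_ord_recr/= lerDl.
    by rewrite mulr_ge0 ?atom_weight_ge0.
  exists 1 => _ [N _ <-]; apply: le_trans (atom_mass_le1 N w).
  apply: ler_sum => j _; by rewrite ler_piMr ?atom_weight_ge0.
exists ((1 - limn (atom_mass ^~ w)) * fine (nu0 B) + limn u); split.
  rewrite /ssp_measure mass_cvg EFinD EFinM fineK ?fin_num_measure// addeC -EFinB.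
  congr (_ + _)%E; apply/cvg_lim => //.
  rewrite (_ : (fun n => _) = EFin \o u).
    by apply: cvg_EFin; [exact: nearW|exact: u_cvg].
  apply/funext => N /=; rewrite big_mkord sumEFin; congr EFin.
  by apply: eq_bigr => j _; rewrite atom_weight_proper.
under eq_fun do rewrite truncated_mixtureE.
by apply: cvgD; [exact: cvg_cst|exact: u_cvg].
Qed.

Lemma measurable_preimages (j : nat) :
  @measurable_fun _ _ (g_sigma_algebraType (preimages p)) R setT (p j).
Proof.
move=> _ A mA; rewrite setTI; apply: sub_sigma_algebra.
by exists j, A.
Qed.

Lemma measurable_proper_weights : @measurable _ (g_sigma_algebraType (preimages p)) proper_weights.
Proof.
rewrite (_ : proper_weights = (\bigcap_j (p j @^-1` `[0, +oo[)) `&`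
    (\bigcap_N ((fun w => \sum_(j < N) p j w) @^-1` `]-oo, 1]))).
  apply: measurableI; apply: bigcapT_measurable => j; rewrite -[X in measurable X]setTI.
    exact: measurable_preimages.
  apply: (@measurable_sum _ (g_sigma_algebraType (preimages p)) R setT 'I_j
    (index_enum 'I_j) (fun i w => p i w)) => // i.
  exact: measurable_preimages.
apply/seteqP; split => w /=.
  by move=> [w0 w1]; split=> n _ /=; rewrite in_itv/= ?andbT; [exact: w0|exact: w1].
move=> [w0 w1]; split => n; first by have := w0 n I; rewrite /= in_itv/= andbT.
by have := w1 n I; rewrite /= in_itv/=.
Qed.

(** Measurability is stated for the sigma-algebra of the weights, since independence from the atoms
    applies only there. The limit of [atom_mass] exists everywhere thanks to the cutoff. *)
Lemma measurable_weight N (j : 'I_N.+1) :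
  @measurable_fun _ _ (g_sigma_algebraType (preimages p)) R setT (weight j).
Proof.
have maw i : @measurable_fun _ _ (g_sigma_algebraType (preimages p)) R setT (atom_weight i).
  apply: measurable_funM; first exact: measurable_preimages.
  by apply: measurable_indic; exact: measurable_proper_weights.
rewrite /weight; case: unliftP => [j'|] _; first exact: maw.
apply: measurable_funB => //.
apply: (@measurable_fun_cvg _ (g_sigma_algebraType (preimages p)) R setT atom_mass).
  move=> m; apply: (@measurable_sum _ (g_sigma_algebraType (preimages p)) R setT 'I_m
    (index_enum 'I_m) (fun i w => atom_weight i w)) => // i.
by move=> w _; exact: is_cvg_atom_mass.
Qed.

Lemma measurable_component N (j : 'I_N.+1) B : measurable B ->
  (forall i, measurable_fun setT (eta i)) ->
  measurable_fun setT (component nu0 eta B j).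
Proof.
move=> mB meta; rewrite /component; case: unliftP => [j'|] _ //.
by apply: measurableT_comp => //; exact: measurable_indic.
Qed.

End truncated_mixture.

Lemma cvg_prodr (R : realType) (I : Type) (s : seq I) (u : I -> nat -> R) (l : I -> R) :
  (forall i, u i N @[N --> \oo] --> l i) ->
  \prod_(i <- s) u i N @[N --> \oo] --> \prod_(i <- s) l i.
Proof.
move=> ul; elim: s => [|i s IH].
  by under eq_fun do rewrite big_nil; rewrite big_nil; exact: cvg_cst.
by under eq_fun do rewrite big_cons; rewrite big_cons; exact: cvgM.
Qed.

Lemma gen_sigma_setT (d d' : measure_display) (T : measurableType d) (I : Type)
  (U : measurableType d') (D : set I) (f : I -> T -> U) : gen_sigma D f setT.
Proof. exact: (@measurableT _ (g_sigma_algebraType _)). Qed.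

(** * Mixture coefficients and the law of the sample on rectangles *)

Section partition_weights.
Context (d : measure_display) (T : measurableType d) (R : realType).
Context (P : probability T R) (nu0 : probability R R) (p eta : nat -> T -> R).
Context (ssp : species_sampling P nu0 p eta).

Lemma prod_weight_itv01 k N (c : 'I_k -> 'I_N.+1) w :
  0 <= \prod_(i < k) weight p (c i) w <= 1.
Proof. by apply: prodr_itv01 => i _; exact: weight_itv01. Qed.

Lemma measurable_prod_weight k N (c : 'I_k -> 'I_N.+1) :
  @measurable_fun _ _ (g_sigma_algebraType (preimages p)) R setT
    (fun w => \prod_(i < k) weight p (c i) w).
Proof.
apply: (@measurable_prod _ (g_sigma_algebraType (preimages p)) R setT 'I_k
  (index_enum 'I_k) (fun i w => weight p (c i) w)) => i _.
exact: measurable_weight.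
Qed.

Definition truncated_partition_weight k N (Pi : {set {set 'I_k}}) : \bar R :=
  (\sum_(c : {ffun 'I_k -> 'I_N.+1} | label_partition c == Pi)
    \int[P]_w (\prod_(i < k) weight p (c i) w)%:E)%E.

(** The mixture coefficient of [Pi]: the total expected weight of all label choices inducing [Pi],
    with infinitely many labels available. [tie_partition_law] identifies it with the EPPF value at
    the block sizes. *)
Definition partition_weight k (Pi : {set {set 'I_k}}) : \bar R :=
  limn (fun N => truncated_partition_weight N Pi).

Lemma integral_prod_weight_ge0 k N (c : 'I_k -> 'I_N.+1) :
  (0 <= \int[P]_w (\prod_(i < k) weight p (c i) w)%:E)%E.
Proof.
by apply: integral_ge0 => w _; rewrite lee_fin; case/andP: (prod_weight_itv01 c w).
Qed.

Lemma truncated_partition_weight_ge0 k N (Pi : {set {set 'I_k}}) :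
  (0 <= truncated_partition_weight N Pi)%E.
Proof. by apply: sume_ge0 => c _; exact: integral_prod_weight_ge0. Qed.

Lemma block_weight_ge0 k (B : nat -> set R) (Pi : {set {set 'I_k}}) :
  (0 <= block_weight nu0 B Pi)%E.
Proof.
apply: prode_ge0 => A _; apply: integral_ge0 => x _; rewrite lee_fin.
exact: prodr_ge0.
Qed.

Lemma block_weight_fin_num k (B : nat -> set R) (Pi : {set {set 'I_k}}) :
  (forall i, measurable (B i)) -> block_weight nu0 B Pi \is a fin_num.
Proof.
move=> mB; apply: prode_fin_num => A _; apply: integral_le1_fin_num.
  by apply: measurable_prod_cond => i; exact: measurable_indic.
by move=> x; apply: prodr_itv01 => i _; exact: indic_itv01.
Qed.

(** Distributivity turns the product of sums into a sum over label functions [c]; the atoms enter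
    each term only through [label_partition c], by which the terms are then grouped. *)
Lemma integral_truncated_mixture k N (B : nat -> set R) :
  (forall i, measurable (B i)) ->
  (\int[P]_w (\prod_(i < k) truncated_mixture nu0 p eta N (B i) w)%:E =
   \sum_(Pi : {set {set 'I_k}}) truncated_partition_weight N Pi * block_weight nu0 B Pi)%E.
Proof.
move=> mB; have meta : forall i, measurable_fun setT (eta i) by case: ssp.
transitivity (\int[P]_w \sum_(c : {ffun 'I_k -> 'I_N.+1})
    (\prod_(i < k) weight p (c i) w * \prod_(i < k) component nu0 eta (B i) (c i) w)%:E)%E.
  apply: eq_integral => w _; rewrite sumEFin bigA_distr_bigA; congr EFin.
  by apply: eq_bigr => c _; rewrite big_split.
rewrite ge0_integral_sum//; first last.
- move=> c w _; rewrite lee_fin mulr_ge0//; first by case/andP: (prod_weight_itv01 c w).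
  by apply: prodr_ge0 => i _; exact: component_ge0.
- move=> c; apply/measurable_EFinP; apply: measurable_funM.
    by apply: (measurable_fun_preimages ssp); exact: measurable_prod_weight.
  by apply: measurable_prod => i _; exact: measurable_component.
rewrite (partition_big (fun c : {ffun 'I_k -> 'I_N.+1} => label_partition c) predT)//=.
apply: eq_bigr => Pi _; rewrite ge0_sume_distrl; last first.
  by move=> c _; exact: integral_prod_weight_ge0.
apply: eq_bigr => c /eqP <-; apply: (integral_component ssp) => //.
- exact: measurable_prod_weight.
- by move=> w; exact: prod_weight_itv01.
Qed.

(** One more label keeps the earlier label functions, with the same partitions and weights (the
    embedding [h]), and adds nonnegative terms. *)
Lemma nondecreasing_truncated_partition_weight k (Pi : {set {set 'I_k}}) :
  nondecreasing_seq (fun N => truncated_partition_weight N Pi).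
Proof.
apply/nondecreasing_seqP => N.
pose h (c : {ffun 'I_k -> 'I_N.+1}) : {ffun 'I_k -> 'I_N.+2} :=
  [ffun i => widen_ord (leqnSn N.+1) (c i)].
have h_inj : injective h.
  move=> c c' /ffunP cc'; apply/ffunP => i; apply/val_inj.
  by have := congr1 val (cc' i); rewrite !ffunE.
have hK c : label_partition (h c) = label_partition c.
  by apply: eq_preim_partition => i j; rewrite !ffunE.
have hw c i w : weight p (h c i) w = weight p (c i) w.
  rewrite ffunE /weight.
  case: unliftP => [a|] /(congr1 val) /= Ea; case: unliftP => [b|] /(congr1 val) /= Eb.
  - by congr (atom_weight p _ w); move: Ea Eb; rewrite /bump; lia.
  - by move: Ea Eb; rewrite /bump; lia.
  - by move: Ea Eb; rewrite /bump; lia.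
  - by [].
rewrite /truncated_partition_weight.
pose img : {set {ffun 'I_k -> 'I_N.+2}} :=
  [set h c | c in [set c : {ffun 'I_k -> 'I_N.+1} | label_partition c == Pi]]%SET.
have imgE (c : {ffun 'I_k -> 'I_N.+2}) : c \in img -> label_partition c == Pi.
  by move=> /imsetP[c0]; rewrite inE => c0Pi ->; rewrite hK.
rewrite [leRHS](bigID (mem img))/=.
rewrite [X in (_ <= X + _)%E](_ : _ = \sum_(c in img)
    \int[P]_w (\prod_(i < k) weight p (c i) w)%:E)%E; last first.
  by apply: eq_bigl => c; apply: andb_idl => /imgE.
rewrite big_imset/=; last by move=> ? ? _ _ /h_inj.
rewrite [X in (_ <= X + _)%E](_ : _ = \sum_(c : {ffun 'I_k -> 'I_N.+1} | label_partition c == Pi)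
    \int[P]_w (\prod_(i < k) weight p (c i) w)%:E)%E; last first.
  apply: eq_big => [c|c _]; first by rewrite inE.
  by apply: eq_integral => w _; congr EFin; apply: eq_bigr => i _; rewrite hw.
by rewrite leeDl//; apply: sume_ge0 => c _; exact: integral_prod_weight_ge0.
Qed.

Lemma cvg_truncated_partition_weight k (Pi : {set {set 'I_k}}) :
  truncated_partition_weight N Pi @[N --> \oo] --> partition_weight Pi.
Proof.
exact/ereal_nondecreasing_is_cvgn/nondecreasing_truncated_partition_weight.
Qed.

Lemma partition_weight_ge0 k (Pi : {set {set 'I_k}}) : (0 <= partition_weight Pi)%E.
Proof.
apply: lime_ge; first exact: cvg_truncated_partition_weight.
by apply: nearW => N; exact: truncated_partition_weight_ge0.
Qed.

(** Lets sums range over the whole finite type of sets of sets, as [mixture_integral] expects. *)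
Lemma partition_weight_nonpartition k (Pi : {set {set 'I_k}}) :
  ~~ finset.partition Pi [set: 'I_k]%SET -> partition_weight Pi = 0%E.
Proof.
move=> nPi; apply/cvg_lim => //; rewrite (_ : (fun N => _) = cst 0%E); first exact: cvg_cst.
apply/funext => N; rewrite /truncated_partition_weight big_pred0// => c.
by apply/negP => /eqP cPi; move: nPi; rewrite -cPi preim_partitionP.
Qed.

(** Almost surely the product of the random masses of the sides is the increasing limit of the
    truncated products. Monotone convergence moves the limit out of the expectation, and then inside
    the finite sum over [Pi]. *)
Lemma rectangle_law (v : nat -> T -> R) :
  cond_iid_given_measure P (ssp_measure nu0 p eta) v ->
  forall (k : nat) (B : nat -> set R), (forall i, measurable (B i)) ->
  (P (\bigcap_(i in `I_k) (v i @^-1` B i)) =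
   \sum_(Pi : {set {set 'I_k}}) partition_weight Pi * block_weight nu0 B Pi)%E.
Proof.
move=> [mv iid] k B mB.
rewrite -[X in P X]setTI iid//; last exact: gen_sigma_setT.
pose S N w := \prod_(i < k) truncated_mixture nu0 p eta N (B i) w.
have S0 N w : 0 <= S N w by apply: prodr_ge0 => i _; exact: truncated_mixture_ge0.
transitivity (\int[P]_w limn (fun N => (S N w)%:E))%E.
  apply: ae_eq_integral_nonmeasurable.
  case: ssp => _ _ ae_p _; apply: filterS ae_p => w [p0 p1].
  have wp : proper_weights p w.
    split=> // N; rewrite -lee_fin -sumEFin -(big_mkord predT (fun j => (p j w)%:E)).
    by apply: le_trans p1; apply: nneseries_lim_ge => j _ _; rewrite lee_fin.
  have /choice[r Hr] : forall i : 'I_k, exists r : R,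
      ssp_measure nu0 p eta w (B i) = r%:E /\
      truncated_mixture nu0 p eta N (B i) w @[N --> \oo] --> r.
    by move=> i; exact: cvg_truncated_mixture.
  under eq_bigr do rewrite (Hr _).1.
  rewrite prodEFin; apply/esym/cvg_lim => //.
  apply: cvg_EFin; first exact: nearW.
  by apply: cvg_prodr => i; exact: (Hr i).2.
rewrite monotone_convergence//; first last.
- move=> w _ N M NM; rewrite lee_fin; apply: ler_prod => i _.
  by rewrite truncated_mixture_ge0; exact: nondecreasing_truncated_mixture.
- by move=> N w _; rewrite lee_fin.
- move=> N; apply/measurable_EFinP; apply: measurable_prod => i _.
  apply: measurable_sum => j; apply: measurable_funM.
    by apply: (measurable_fun_preimages ssp); exact: measurable_weight.
  by apply: measurable_component => //; case: ssp.
apply/cvg_lim => //; under eq_fun do rewrite integral_truncated_mixture//.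
apply: cvg_nnesum => Pi _.
  by apply: nearW => N; rewrite mule_ge0 ?block_weight_ge0 ?truncated_partition_weight_ge0.
apply: cvgeZr; first exact: block_weight_fin_num.
exact: cvg_truncated_partition_weight.
Qed.

End partition_weights.

(** * From rectangles to the law of the sample and of its ties *)

Lemma preim_partition_inj (I : finType) (V V' : eqType) (f : I -> V) (g : I -> V') :
  preim_partition f [set: I]%SET = preim_partition g [set: I]%SET ->
  forall i j, (f i == f j) = (g i == g j).
Proof.
move=> fg i j; have : [set j | f i == f j]%SET \in preim_partition f [set: I]%SET.
  by apply/imsetP; exists i; rewrite ?inE//; apply/setP => j'; rewrite !inE.
rewrite fg => /imsetP[i' _ /setP E].
have := E i; have := E j; rewrite !inE eqxx /= => -> /esym/eqP <-.
by [].
Qed.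

(** Ranking a block among all subsets of ['I_k], not among the blocks of [Pi], gives a type that
    does not depend on [Pi]. *)
Definition block_rank (k : nat) (Pi : {set {set 'I_k}}) (i : 'I_k) : 'I_#|{set 'I_k}| :=
  enum_rank (finset.pblock Pi i).

Lemma preim_partition_block_rank (k : nat) (Pi : {set {set 'I_k}}) :
  finset.partition Pi [set: 'I_k]%SET ->
  preim_partition (block_rank Pi) [set: 'I_k]%SET = Pi.
Proof.
move=> partPi; rewrite -[RHS](preim_partition_pblock partPi).
by apply: eq_preim_partition => i j; rewrite (inj_eq enum_rank_inj).
Qed.

Section laws.
Context (d : measure_display) (T : measurableType d) (R : realType).
Context (P : probability T R) (nu0 : probability R R) (p eta : nat -> T -> R).
Context (ssp : species_sampling P nu0 p eta).

(** The pair of atoms has law [nu0 \x nu0], and the sections of the diagonal are points, null as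
    [nu0] is diffuse. *)
Lemma atoms_tie_null (i j : nat) : (forall x : R, nu0 [set x] = 0%E) -> i != j ->
  P [set w | eta i w = eta j w] = 0%E.
Proof.
move=> diffuse ij; have [_ meta _ indep] := ssp.
pose X w := (eta i w, eta j w).
have mX : measurable_fun setT X by exact: measurable_fun_pair.
pose X' : {RV P >-> (R * R)%type} := HB.pack X (isMeasurableFun.Build _ _ _ _ X mX).
have lawX A B : measurable A -> measurable B ->
    distribution P X' (A `*` B) = (nu0 A * nu0 B)%E.
  (* Independence is given for initial segments of the atoms, so the segment reaches the larger
     index, with full sides except at [i] and [j]. *)
  move=> mA mB; pose C l := if l == i then A else if l == j then B else setT.
  have ik : (i < (maxn i j).+1)%N by rewrite ltnS leq_maxl.
  have jk : (j < (maxn i j).+1)%N by rewrite ltnS leq_maxr.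
  have := indep (maxn i j).+1 C setT; rewrite setTI probability_setT mul1e.
  rewrite (bigD1 (Ordinal ik))//= (bigD1 (Ordinal jk))/=; last by rewrite -val_eqE/= eq_sym.
  have -> : C i = A by rewrite /C eqxx.
  have -> : C j = B by rewrite /C eq_sym (negbTE ij) eqxx.
  rewrite big1 ?mule1; last first.
    move=> l /andP[li lj]; rewrite /C; move: li lj; rewrite -!val_eqE/= => /negbTE -> /negbTE ->.
    exact: probability_setT.
  move=> <-; last 2 first.
  - by move=> l; rewrite /C; case: ifP => // _; case: ifP.
  - exact: gen_sigma_setT.
  congr (P _); apply/seteqP; split => w /=.
    move=> [Ai Bj] l _ /=; rewrite /C; case: eqP => [->//|_]; by case: eqP => [->|].
  move=> H; split; [have := H i ik|have := H j jk]; rewrite /C /= ?eqxx//.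
  by rewrite eq_sym (negbTE ij).
have mdiag : measurable [set x : R * R | x.1 = x.2].
  have := @measurable_fun_eqr _ (R * R)%type R setT fst snd measurable_fst measurable_snd.
  move=> /(_ measurableT [set true] I); rewrite setTI.
  by congr (measurable _); apply/seteqP; split => x /= /eqP.
have -> : [set w | eta i w = eta j w] = X @^-1` [set x : R * R | x.1 = x.2] by [].
transitivity ((nu0 \x nu0)%E [set x : R * R | x.1 = x.2]).
  by rewrite (product_measure_unique lawX).
rewrite /product_measure1 integral0_eq// => x _ /=.
rewrite (_ : xsection _ _ = [set x])//; apply/seteqP; split => y; rewrite /xsection/= inE/=.
  by move=> ->.
by move=> ->.
Qed.

(** Indices read the same atom exactly when they share a block, so atoms realize the law behind
    [block_weight]. *)
Lemma block_weight_block_rank (k : nat) (B : nat -> set R) (Pi : {set {set 'I_k}}) :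
  (forall i, measurable (B i)) -> finset.partition Pi [set: 'I_k]%SET ->
  block_weight nu0 B Pi = P [set w | forall i : 'I_k, B i (eta (block_rank Pi i) w)].
Proof.
move=> mB partPi; have meta : forall i, measurable_fun setT (eta i) by case: ssp.
rewrite /block_weight -{1}(preim_partition_block_rank partPi).
rewrite -(indep_integral_partition _ ssp); first last.
- by move=> i x; exact: indic_itv01.
- by move=> i; exact: measurable_indic.
under eq_integral do rewrite (prod_indic R (fun i : 'I_k => B i) (fun i => eta (block_rank Pi i))).
rewrite integral_indic ?setIT//.
exact: (measurable_forall (C := fun i : 'I_k => B i) (f := fun i => eta (block_rank Pi i))).
Qed.

Context (v : nat -> T -> R) (vP : cond_iid_given_measure P (ssp_measure nu0 p eta) v).

Lemma sample_integral (k : nat) (F : k.-tuple R -> \bar R) :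
  measurable_fun setT F -> (forall x, 0 <= F x)%E ->
  (\int[P]_w F [tuple v i w | i < k] =
   \sum_(Pi : {set {set 'I_k}} | finset.partition Pi [set: 'I_k]%SET)
     partition_weight P p Pi * \int[P]_w F [tuple eta (block_rank Pi i) w | i < k])%E.
Proof.
move=> mF F0; have meta : forall i, measurable_fun setT (eta i) by case: ssp.
have mv : forall i, measurable_fun setT (v i) by case: vP.
have mtup (h : 'I_k -> T -> R) : (forall i, measurable_fun setT (h i)) ->
    measurable_fun setT (fun w => [tuple h i w | i < k]).
  move=> mh; apply/measurable_fun_tnthP => i.
  by rewrite (_ : _ \o _ = h i)//; apply/funext => w /=; rewrite tnth_mktuple.
rewrite (@mixture_integral _ _ T R R P k {set {set 'I_k}} (fun w => [tuple v i w | i < k])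
  (fun Pi w => [tuple eta (block_rank Pi i) w | i < k]) (partition_weight P p (k := k)))//.
- rewrite [RHS]big_mkcond; apply: eq_bigr => Pi _; case: ifPn => // nPi.
  by rewrite partition_weight_nonpartition// mul0e.
- exact: mtup.
- by move=> Pi; exact: mtup.
- by move=> Pi; exact: partition_weight_ge0.
move=> B mB.
(* [rectangle_law] takes sides indexed by all naturals; those beyond [k] are full. *)
pose C i := if insub i is Some j then B j else setT.
have CE (i : 'I_k) : C i = B i by rewrite /C valK.
have mC i : measurable (C i) by rewrite /C; case: insubP.
transitivity (P (\bigcap_(i in `I_k) (v i @^-1` C i))).
  congr (P _); apply/seteqP; split => w /= H i.
    by move=> ik; have := H (Ordinal ik); rewrite tnth_mktuple -CE.
  by rewrite tnth_mktuple -CE; exact: (H i (ltn_ord i)).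
rewrite (rectangle_law ssp vP)//; apply: eq_bigr => Pi _.
have [partPi|nPi] := boolP (finset.partition Pi [set: 'I_k]%SET); last first.
  by rewrite partition_weight_nonpartition// !mul0e.
rewrite block_weight_block_rank//; congr (_ * P _)%E.
by apply/seteqP; split => w /= H i; have := H i; rewrite tnth_mktuple CE.
Qed.

Lemma sample_prod_integral (k : nat) (f : 'I_k -> R -> R) :
  (forall i, measurable_fun setT (f i)) -> (forall i x, 0 <= f i x <= 1) ->
  (\int[P]_w (\prod_(i < k) f i (v i w))%:E =
   \sum_(Pi : {set {set 'I_k}} | finset.partition Pi [set: 'I_k]%SET)
     partition_weight P p Pi * \prod_(A in Pi) \int[nu0]_x (\prod_(i in A) f i x)%:E)%E.
Proof.
move=> mf f01.
pose F (x : k.-tuple R) := (\prod_(i < k) f i (tnth x i))%:E.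
have FE (h : 'I_k -> R) : F [tuple h i | i < k] = (\prod_(i < k) f i (h i))%:E.
  by congr EFin; apply: eq_bigr => i _; rewrite tnth_mktuple.
under eq_integral do rewrite -(FE (fun i => v i _)).
rewrite sample_integral.
- apply: eq_bigr => Pi partPi; congr (_ * _)%E.
  rewrite -[in RHS](preim_partition_block_rank partPi) -(indep_integral_partition _ ssp)//.
  by apply: eq_integral => w _; rewrite FE.
- apply/measurable_EFinP; apply: measurable_prod => i _.
  by apply: measurableT_comp => //; exact: measurable_tnth.
- move=> x; rewrite lee_fin; apply: prodr_ge0 => i _.
  by case/andP: (f01 i (tnth x i)).
Qed.

(** [sample_integral] is applied to the indicator of the tuples whose ties induce [Pi]. As the atoms
    are almost surely distinct, the component of [Pi'] has ties inducing exactly [Pi'], so only the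
    term of [Pi] survives. *)
Lemma tie_partition_law (k : nat) (Pi : {set {set 'I_k}}) :
  (forall x : R, nu0 [set x] = 0%E) -> finset.partition Pi [set: 'I_k]%SET ->
  P [set w | tie_partition k v w = Pi] = partition_weight P p Pi.
Proof.
move=> diffuse partPi; have meta : forall i, measurable_fun setT (eta i) by case: ssp.
have mv : forall i, measurable_fun setT (v i) by case: vP.
pose S := [set x : k.-tuple R | preim_partition (tnth x) [set: 'I_k]%SET = Pi].
have mS : measurable S.
  rewrite (_ : S = \bigcap_(ij in [set: 'I_k * 'I_k])
      ((fun x : k.-tuple R => tnth x ij.1 == tnth x ij.2) @^-1`
       [set (block_rank Pi ij.1 == block_rank Pi ij.2)])).
    apply: fin_bigcap_measurable => [|ij _]; first exact: finite_finset.
    rewrite -[X in measurable X]setTI.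
    by apply: measurable_fun_eqr => //; exact: measurable_tnth.
  apply/seteqP; split => x /=.
    move=> xPi ij _ /=; apply: preim_partition_inj.
    by rewrite preim_partition_block_rank.
  move=> H; rewrite /S /= -[RHS](preim_partition_block_rank partPi).
  by apply: eq_preim_partition => i j; exact: (H (i, j) I).
have tieE (u : 'I_k -> T -> R) : (forall i, measurable_fun setT (u i)) ->
    (\int[P]_w (\1_S [tuple u i w | i < k])%:E =
     P [set w | preim_partition (fun i => u i w) [set: 'I_k]%SET = Pi])%E.
  move=> mu; pose U w := [tuple u i w | i < k].
  have mU : measurable_fun setT U.
    apply/measurable_fun_tnthP => i.
    by rewrite (_ : _ \o _ = u i)//; apply/funext => w /=; rewrite tnth_mktuple.
  rewrite -[LHS]/(\int[P]_w (\1_(U @^-1` S) w)%:E)%E.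
  rewrite integral_indic ?setIT//; last by rewrite -[X in measurable X]setTI; exact: mU.
  have UE w : preim_partition (tnth (U w)) [set: 'I_k]%SET =
      preim_partition (fun i => u i w) [set: 'I_k]%SET.
    by apply: eq_preim_partition => i j; rewrite !tnth_mktuple.
  by congr (P _); apply/seteqP; split => w; rewrite /S /= UE.
rewrite -[LHS](tieE (fun i : 'I_k => v i))//.
rewrite (@sample_integral k (fun x => (\1_S x)%:E)); first last.
- by move=> x; rewrite lee_fin.
- by apply/measurable_EFinP; exact: measurable_indic.
(* Only finitely many atoms are read, so a finite intersection of almost sure events suffices. *)
have distinct : {ae P, forall w, forall ij : 'I_#|{set 'I_k}| * 'I_#|{set 'I_k}|,
    ij.1 != ij.2 -> eta ij.1 w <> eta ij.2 w}.
  apply: filter_forall => -[i j] /=; have [->|ij] := eqVneq i j; first exact: nearW.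
  exists [set w | eta i w = eta j w]; split.
  - rewrite (_ : [set _ | _] = (fun w => eta i w == eta j w) @^-1` [set true]).
      by rewrite -[X in measurable X]setTI; exact: measurable_fun_eqr.
    by apply/seteqP; split => w /= /eqP.
  - exact: atoms_tie_null.
  - by move=> w /= H; apply: contrapT => Hij; apply: H => _.
have atomsE Pi' : finset.partition Pi' [set: 'I_k]%SET ->
    (\int[P]_w (\1_S [tuple eta (block_rank Pi' i) w | i < k])%:E = (Pi' == Pi)%:R%:E)%E.
  move=> partPi'; transitivity (\int[P]_w (cst (Pi' == Pi)%:R%:E w))%E; last first.
    by rewrite integral_cst// -[RHS]mule1; congr (_ * _)%E; exact: probability_setT.
  apply: ae_eq_integral_nonmeasurable; apply: filterS distinct => w w_distinct.
  have E : preim_partition (tnth [tuple eta (block_rank Pi' i) w | i < k]) [set: 'I_k]%SET = Pi'.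
    rewrite -[RHS](preim_partition_block_rank partPi').
    apply: eq_preim_partition => i j; rewrite !tnth_mktuple.
    have [->|rij] := eqVneq (block_rank Pi' i) (block_rank Pi' j); first by rewrite eqxx.
    by apply/eqP; exact: (w_distinct (_, _) rij).
  rewrite indicE /S; congr (_%:R%:E); congr nat_of_bool.
  by apply/idP/eqP => [/set_mem/= <-//|<-]; rewrite inE /=.
rewrite (bigD1 Pi)//= atomsE// eqxx mule1 big1 ?adde0// => Pi' /andP[partPi' /negbTE PiPi'].
by rewrite atomsE// PiPi' mule0.
Qed.

End laws.

(** * The stick-breaking product and the conclusion *)

(** In the weight of label [e l], stick [i] appears as [v i] if [i = e l], as [1 - v i] if
    [i < e l], and not at all otherwise; exchanging the products counts these cases over [l]. *)
Lemma prod_stick (T : Type) (R : realType) (v : nat -> T -> R) (n : nat)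
  (e : 'I_n -> nat) (w : T) :
  \prod_(l < n) stick v (e l) w =
  \prod_(i < kmax e) (v i w ^+ #|[set l : 'I_n | e l == i]| *
                      (1 - v i w) ^+ #|[set l : 'I_n | (i < e l)%N]|).
Proof.
have ek l : (e l < kmax e)%N by rewrite ltnS leq_bigmax.
transitivity (\prod_(l < n) \prod_(i < kmax e)
    ((if e l == i :> nat then v i w else 1) * (if (i < e l)%N then 1 - v i w else 1))).
  apply: eq_bigr => l _; rewrite /stick big_split/= -!big_mkcond/=; congr (_ * _).
    by rewrite (big_pred1 (Ordinal (ek l)))// => i; rewrite -val_eqE /= eq_sym.
  by rewrite (big_ord_widen (kmax e) (fun i => 1 - v i w) (ltnW (ek l))).
rewrite exchange_big; apply: eq_bigr => i _; rewrite big_split/= -!big_mkcond/= !prodr_const.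
by congr (_ ^+ _ * _ ^+ _); apply: eq_card => l;
  apply/idP/idP => [h|/set_mem//]; exact: mem_set.
Qed.

Unset Implicit Arguments.

Theorem theorem4 (d : measure_display) (T : measurableType d) (R : realType)
  (P : probability T R) (nu0 : probability R R)
  (p eta v : nat -> T -> R) (dd : nat -> T -> nat) :
  diffuse_on01 nu0 ->
  species_sampling P nu0 p eta ->
  (forall i w, 0 <= v i w <= 1) ->
  cond_iid_given_measure P (ssp_measure nu0 p eta) v ->
  cond_iid_given_weights P (stick v) dd ->
  forall (n : nat) (e : 'I_n -> nat), (0 < n)%N ->
  P [set w | forall l : 'I_n, dd l w = e l]
  = (\sum_(Pi : {set {set 'I_(kmax e)}} | finset.partition Pi [set: 'I_(kmax e)]%SET)
       (P [set w | tie_partition (kmax e) v w = Pi]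
        * \prod_(A | A \in Pi)
            \int[nu0]_(x in `[0%R, 1%R]%classic)
               (x ^+ rsum e A * (1 - x) ^+ tsum e A)%:E))%E.
Proof.
move=> [nu01 diffuse] ssp v01 vP ddP n e n0.
have [mv _] := vP.
(* The indicator keeps [f i] between 0 and 1 on the whole line, as [sample_prod_integral] requires;
   on the values of [v] it equals 1. *)
pose f (i : 'I_(kmax e)) (x : R) : R := \1_(`[0, 1]%classic : set R) x *
  (x ^+ #|[set l : 'I_n | e l == i]| * (1 - x) ^+ #|[set l : 'I_n | (i < e l)%N]|).
have mf i : measurable_fun setT (f i).
  apply: measurable_funM; first exact: measurable_indic.
  by apply: measurable_funM; apply: measurable_funX => //; exact: measurable_funB.
have f01 i x : 0 <= f i x <= 1.
  rewrite /f indicE; have [|_] := boolP (x \in _); last by rewrite mul0r lexx ler01.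
  rewrite inE /= in_itv /= => /andP[x0 x1]; rewrite mul1r.
  have y0 : 0 <= 1 - x by rewrite subr_ge0.
  have y1 : 1 - x <= 1 by rewrite gerBl.
  by rewrite mulr_ge0 ?exprn_ge0//= mulr_ile1 ?exprn_ge0 ?exprn_ile1.
have -> : P [set w | forall l : 'I_n, dd l w = e l] =
    (\int[P]_w (\prod_(i < kmax e) f i (v i w))%:E)%E.
  have := ddP.2 n e setT (@gen_sigma_setT _ _ _ _ _ _ _); rewrite setTI => ->.
  apply: eq_integral => w _; rewrite prodEFin prod_stick; congr EFin.
  apply: eq_bigr => i _; rewrite /f indicE mem_set ?mul1r//=.
  by rewrite in_itv /=; exact: v01.
rewrite (sample_prod_integral ssp vP)//; apply: eq_bigr => Pi partPi.
rewrite (tie_partition_law ssp vP)//; congr (_ * _)%E.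
apply: eq_bigr => A APi; rewrite [RHS]integral_mkcond; apply: eq_integral => x _.
(* A block is nonempty, so outside the unit interval its product contains a zero factor and the
   integral over the line reduces to one over the interval. *)
have [i iA] : exists i, i \in A.
  apply/set0Pn; apply: contraTneq APi => ->.
  by case/and3P: partPi.
rewrite patchE; case: ifPn => x01.
  congr EFin; rewrite /rsum /tsum !expr_sum -big_split/=.
  by apply: eq_bigr => j _; rewrite /f indicE x01 mul1r.
by rewrite (bigD1 i)//= /f indicE (negbTE x01) !mul0r.
Qed.
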